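(* (1) A profile function $(h,k)$ is minimal if and only if for all $i,n\ge0$: $\tau_i^{2^n}\in I(h,k)$ is equivalent to $n\ge k(i)$. (2) Let $(h,k)$ be a profile function. Then the profile function $(h,\tilde k)$ defined by $\tilde k:\mathbb{N}\to\mathbb{N}\cup\{\infty\}$, $\tilde k(n)=\min\{l\in\mathbb{N}\mid\tau_n^{2^l}\in I(h,k)\}$ (with $\min\emptyset=\infty$), is the unique minimal profile function such that $I(h,k)=I(h,\tilde k)$.
   Context: $RO(\mathbb{Z}/2)=\mathbb{Z}\oplus\mathbb{Z}\alpha$, where $\alpha$ is the sign representation; $\star$ denotes $RO(\mathbb{Z}/2)$-grading. $H_\star=(H\underline{\mathbb{F}}_2)_\star^{\mathbb{Z}/2}$ is the $RO(\mathbb{Z}/2)$-graded coefficient ring of the genuine $\mathbb{Z}/2$-equivariant Eilenberg-MacLane spectrum of the constant Mackey functor $\underline{\mathbb{F}}_2$ (restriction the identity, transfer $0$); $a\in H_{-\alpha}$ is the Euler class (the class of $S^0\hookrightarrow S^\alpha$), $\sigma^{-1}\in H_{1-\alpha}$ is the nonzero element. The dual Steenrod algebra is (Hu-Kriz) $\mathcal{A}_\star=(H\underline{\mathbb{F}}_2)_\star^{\mathbb{Z}/2}(H\underline{\mathbb{F}}_2)=H_\star[\xi_{i+1},\tau_i\mid i\ge0]/(\tau_i^2=a\tau_{i+1}+\eta_R(\sigma^{-1})\xi_{i+1})$ with $\eta_R(\sigma^{-1})=\sigma^{-1}+a\tau_0$, $|\xi_i|=(2^i-1)(1+\alpha)$,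 $|\tau_i|=(2^i-1)(1+\alpha)+1$. A profile function is a pair of maps $h:\mathbb{N}\setminus\{0\}\to\mathbb{N}\cup\{\infty\}$, $k:\mathbb{N}\to\mathbb{N}\cup\{\infty\}$; $I(h,k)\subset\mathcal{A}_\star$ is the two-sided ideal generated by the $\xi_i^{2^{h(i)}}$ ($i\ge1$) and $\tau_i^{2^{k(i)}}$ ($i\ge0$), with the convention $x^{2^\infty}=0$. The order is $(h,k)\le(h',k')$ iff $h(n+1)\le h'(n+1)$ and $k(n)\le k'(n)$ for all $n\ge0$. $(h,k)$ is minimal if it is minimal among the profile functions $(h',k')$ such that $I(h',k')=I(h,k)$. *)

(* Defs.v *)
From HB Require Import structures.
From mathcomp Require Import all_boot all_order all_algebra finmap.
From mathcomp Require Import ring_quotient.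
From mathcomp Require Import boolp classical_sets.
From mathcomp.multinomials Require Import monalg.
From mathcomp Require Import ring zify.

Set Implicit Arguments.
Unset Strict Implicit.
Unset Printing Implicit Defensive.

Import GRing.Theory.

Local Open Scope ring_scope.

Definition two_sided_ideal (R : nzRingType) (J : set R) : Prop :=
  [/\ J 0,
      forall x y, J x -> J y -> J (x - y)
    & forall r x, J x -> J (r * x) /\ J (x * r)].

Definition gen_ideal (R : nzRingType) (S : set R) : set R :=
  smallest (@two_sided_ideal R) S.

Lemma gen_idealP (R : nzRingType) (S : set R) : two_sided_ideal (gen_ideal S).
Proof.
split.
- by move=> J [[J0 _ _] _].
- by move=> x y Sx Sy J JS; case: (JS) => -[_ JB _] _; apply: JB; [exact: Sx|exact: Sy].
- move=> r x Sx; split=> J JS; case: (JS) => -[_ _ JM] _;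
  by have [] := JM r x (Sx _ JS).
Qed.

(* The coefficient ring H_star is built from its known computation (Stong,
  Hu-Kriz).  Additively, H_star = F_2[a, u] (+) NC with u = sigma^-1, where the "negative
  cone" NC has F_2-basis the classes theta / (a^i u^j), i, j >= 0, with theta in
  degree 2 alpha - 2.  The product is the one of the polynomial ring on
  F_2[a, u], it is zero on NC x NC, and F_2[a, u] acts on NC by
  a^i u^j . theta / (a^k u^l) = theta / (a^(k-i) u^(l-j)) if i <= k and j <= l,
  and by 0 otherwise.  [Hstar] is the direct sum of all the graded pieces. *)

Inductive Hbasis : predArgType :=
| PosCone of nat & nat  (* PosCone i j = a^i u^j *)
| NegCone of nat & nat. (* NegCone i j = theta / (a^i u^j) *)

Definition sum_of_Hbasis (x : Hbasis) : nat * nat + nat * nat :=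
  match x with PosCone i j => inl (i, j) | NegCone i j => inr (i, j) end.

Definition Hbasis_of_sum (x : nat * nat + nat * nat) : Hbasis :=
  match x with inl (i, j) => PosCone i j | inr (i, j) => NegCone i j end.

Lemma sum_of_HbasisK : cancel sum_of_Hbasis Hbasis_of_sum.
Proof. by case. Qed.

HB.instance Definition _ := Countable.copy Hbasis (can_type sum_of_HbasisK).

(* [None] stands for a zero product. *)
Definition Hbasis_mul (x y : Hbasis) : option Hbasis :=
  match x, y with
  | PosCone i j, PosCone k l => Some (PosCone (i + k) (j + l))
  | PosCone i j, NegCone k l | NegCone k l, PosCone i j =>
      if (i <= k)%N && (j <= l)%N then Some (NegCone (k - i) (l - j)) else None
  | NegCone _ _, NegCone _ _ => None
  end.

(* The RO(Z/2)-degree, (p, q) standing for p + q alpha. *)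
Definition Hbasis_deg (x : Hbasis) : int * int :=
  match x with
  | PosCone i j => (j%:Z, - (i + j)%N%:Z)
  | NegCone i j => (- (j + 2)%N%:Z, (i + j + 2)%N%:Z)
  end.

Lemma Hbasis_mul_deg x y z :
  Hbasis_mul x y = Some z -> Hbasis_deg z = Hbasis_deg x + Hbasis_deg y.
Proof.
case: x y => i j [] k l //=; last first.
- by case: ifP => // /andP[ki lj] [<-]; congr pair; rewrite /= ?PoszD -?subzn //; ring.
- by case: ifP => // /andP[ki lj] [<-]; congr pair; rewrite /= ?PoszD -?subzn //; ring.
- by case=> <-; congr pair; rewrite /= !PoszD; ring.
Qed.

Definition Hstar := {malg 'F_2[Hbasis]}.

HB.instance Definition _ := GRing.Zmodule.on Hstar.

Section HstarRing.
Implicit Types (f g : Hstar) (x y z : Hbasis) (c d : 'F_2).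
Local Open Scope fset_scope.
Local Open Scope ring_scope.

Definition Hmonom c (o : option Hbasis) : Hstar :=
  if o is Some z then << c *g z >> else 0.

Definition Hmul f g : Hstar :=
  \sum_(x <- msupp f) \sum_(y <- msupp g) Hmonom (f@_x * g@_y) (Hbasis_mul x y).

Lemma Hmonom0 o : Hmonom 0 o = 0.
Proof. by case: o => //= z; rewrite monalgU0. Qed.

Lemma HmonomD c d o : Hmonom (c + d) o = Hmonom c o + Hmonom d o.
Proof. by case: o => //= [z|]; rewrite ?monalgUD ?addr0. Qed.

Lemma HmulEw (d1 d2 : {fset Hbasis}) f g :
  msupp f `<=` d1 -> msupp g `<=` d2 ->
  Hmul f g = \sum_(x <- d1) \sum_(y <- d2) Hmonom (f@_x * g@_y) (Hbasis_mul x y).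
Proof.
move=> le1 le2; rewrite /Hmul (big_fset_incl _ le1) /=.
  apply/eq_bigr=> x _; apply/big_fset_incl => // y _ /mcoeff_outdom ->.
  by rewrite mulr0 Hmonom0.
move=> x _ /mcoeff_outdom fx.
by rewrite big1 // => y _; rewrite fx mul0r Hmonom0.
Qed.

Lemma HmulDl : left_distributive Hmul +%R.
Proof.
move=> f1 f2 g.
rewrite [in RHS](HmulEw (fsubsetUl _ (msupp f2)) (fsubset_refl _)).
rewrite [in RHS](HmulEw (fsubsetUr (msupp f1) _) (fsubset_refl _)).
rewrite (HmulEw (msuppD_le _ _) (fsubset_refl _)) -big_split /=.
apply/eq_bigr=> x _; rewrite -big_split /=; apply/eq_bigr=> y _.
by rewrite mcoeffD mulrDl HmonomD.
Qed.

Lemma Hbasis_mulC x y : Hbasis_mul x y = Hbasis_mul y x.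
Proof. by case: x y => i j [] k l //=; rewrite [(i + k)%N]addnC [(j + l)%N]addnC. Qed.

Lemma HmulC : commutative Hmul.
Proof.
move=> f g; rewrite /Hmul exchange_big; apply/eq_bigr=> y _; apply/eq_bigr=> x _.
by rewrite mulrC Hbasis_mulC.
Qed.

Lemma HmulDr : right_distributive Hmul +%R.
Proof. by move=> f g1 g2; rewrite HmulC HmulDl !(HmulC f). Qed.

Lemma Hmul0l g : Hmul 0 g = 0.
Proof. by rewrite /Hmul msupp0 big_seq_fset0. Qed.

Lemma Hmul0r g : Hmul g 0 = 0.
Proof. by rewrite HmulC Hmul0l. Qed.

Lemma HmulUU c d x y :
  Hmul << c *g x >> << d *g y >> = Hmonom (c * d) (Hbasis_mul x y).
Proof. by rewrite (HmulEw msuppU_le msuppU_le) !big_seq_fset1 !mcoeffUU. Qed.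

Lemma Hmul_suml (T : Type) (r : seq T) (F : T -> Hstar) g :
  Hmul (\sum_(t <- r) F t) g = \sum_(t <- r) Hmul (F t) g.
Proof. exact: (big_morph (Hmul^~ g) (fun _ _ => HmulDl _ _ _) (Hmul0l g)). Qed.

Lemma Hmul_sumr (T : Type) (r : seq T) (F : T -> Hstar) g :
  Hmul g (\sum_(t <- r) F t) = \sum_(t <- r) Hmul g (F t).
Proof. exact: (big_morph (Hmul g) (fun _ _ => HmulDr _ _ _) (Hmul0r g)). Qed.

Lemma HmulEl f g : Hmul f g = \sum_(x <- msupp f) Hmul << f@_x *g x >> g.
Proof. by rewrite [f in LHS]monalgE Hmul_suml. Qed.

Lemma HmulEr f g : Hmul f g = \sum_(x <- msupp g) Hmul f << g@_x *g x >>.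
Proof. by rewrite [g in LHS]monalgE Hmul_sumr. Qed.

Lemma Hbasis_mulA x y z :
  obind (Hbasis_mul x) (Hbasis_mul y z) =
  obind (Hbasis_mul^~ z) (Hbasis_mul x y).
Proof.
by case: x y z => i j [] k l [] m n /=; do ?[case: ifP => /=]; move=> *;
  first [ by [] | by congr (Some (PosCone _ _)); lia
        | by congr (Some (NegCone _ _)); lia | by exfalso; lia ].
Qed.

Lemma HmulA : associative Hmul.
Proof.
move=> f g h; rewrite (HmulEl f (Hmul g h)) (HmulEl f g) Hmul_suml.
apply: eq_bigr => x _; rewrite (HmulEl g h) (HmulEr _ g) Hmul_suml Hmul_sumr.
apply: eq_bigr => y _; rewrite (HmulEr _ h) (HmulEr (Hmul _ _) h) Hmul_sumr.
apply: eq_bigr => z _.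
rewrite !HmulUU; have := Hbasis_mulA x y z.
case: (Hbasis_mul y z) => [v|]; case: (Hbasis_mul x y) => [w|] //=;
  rewrite ?HmulUU ?Hmul0l ?Hmul0r ?mulrA //.
- by move=> ->.
- by move=> ->.
- by move=> <-.
Qed.

Lemma Hmul1l : left_id << PosCone 0 0 >> Hmul.
Proof.
move=> f; rewrite [f in LHS]monalgE [f in RHS]monalgE Hmul_sumr.
by apply: eq_bigr => x _; rewrite HmulUU mul1r; case: x => i j /=; rewrite ?subn0.
Qed.

Lemma Hone_neq0 : << PosCone 0 0 >> != 0 :> Hstar.
Proof. by rewrite monalgU_eq0 oner_eq0. Qed.

HB.instance Definition _ := GRing.Zmodule_isComNzRing.Build Hstar
  HmulA HmulC Hmul1l HmulDl Hone_neq0.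

End HstarRing.

Definition Ha : Hstar := << PosCone 1 0 >>.
Definition Hsigma_inv : Hstar := << PosCone 0 1 >>.

Definition posnat := {n : nat | (0 < n)%N}.
Definition psucc (n : nat) : posnat := exist _ n.+1 isT.

(* Indices of the polynomial generators: [inl i] for xi_i, [inr i] for tau_i. *)
Definition Agen : choiceType := (posnat + nat)%type.

(* The presentation H[xi_i, tau_i] / (tau_i^2 = a tau_{i+1} + (s + a tau_0) xi_{i+1})
   makes sense over any commutative ring H with elements a, s; it is applied
   below to H_star, its Euler class and sigma^-1. *)
Section Presentation.
Variables (H : comNzRingType) (a s : H).

Definition Apoly : comNzRingType := {malg H[{cmonom Agen}]}.

Definition pxi (i : posnat) : Apoly := << ucm (inl i : Agen) >>.
Definition ptau (i : nat) : Apoly := << ucm (inr i : Agen) >>.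

(* The lift of eta_R (sigma^-1). *)
Definition peta_sigma_inv : Apoly := s%:MP + a%:MP * ptau 0.

Definition Arel (i : nat) : Apoly :=
  ptau i ^+ 2 - (a%:MP * ptau i.+1 + peta_sigma_inv * pxi (psucc i)).

Definition Arel_ideal : {pred Apoly} := fun x => `[< gen_ideal (range Arel) x >].

Let aug : {rmorphism Apoly -> H} := @mcoeff {cmonom Agen} H mone.

Lemma aug_rel i : aug (Arel i) = 0.
Proof.
have aug_gen (g : Agen) : aug (<< ucm g >> : {malg H[{cmonom Agen}]}) = 0.
  rewrite /= mcoeffU1; case: eqP => // /eqP/cmP/(_ g).
  by rewrite ucmE onecmE eqxx.
have aug_tau j : aug (ptau j) = 0 by exact: aug_gen.
have aug_xi j : aug (pxi j) = 0 by exact: aug_gen.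
have rel0 (P S : comNzRingType) (f : {rmorphism P -> S}) (t t' x b c : P) :
    f t = 0 -> f t' = 0 -> f x = 0 -> f (t ^+ 2 - (b * t' + c * x)) = 0.
  move=> t0 t'0 x0; rewrite rmorphB rmorphD rmorphXn !rmorphM t0 t'0 x0.
  by rewrite !mulr0 expr0n addr0 subr0.
by apply: rel0; [exact: aug_tau|exact: aug_tau|exact: aug_xi].
Qed.

Fact Arel_ideal_closed : idealr_closed Arel_ideal.
Proof.
have [J0 JB JM] := gen_idealP (range Arel).
split; first exact/asboolP.
  apply/asboolPn => /(_ (fun x => aug x = 0)) J1.
  suff /J1/eqP : two_sided_ideal (fun x => aug x = 0) /\
      (range Arel `<=` (fun x => aug x = 0))%classic.
    by rewrite rmorph1 oner_eq0.
  split; last by move=> _ [i _ <-]; exact: aug_rel.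
  split; first exact: rmorph0.
  - by move=> x y x0 y0; rewrite rmorphB x0 y0 subrr.
  - by move=> r x x0; split; rewrite (rmorphM aug) x0 ?mulr0 ?mul0r.
move=> r x y /asboolP Jx /asboolP Jy; apply/asboolP.
have [Jrx _] := JM r x Jx.
by rewrite -[y]opprK; apply: (JB) => //; rewrite -sub0r; apply: JB.
Qed.

HB.instance Definition _ := isIdealr.Build Apoly Arel_ideal Arel_ideal_closed.

Definition Aquot : comNzRingType := {ideal_quot Arel_ideal}.

Definition Aquot_pi : Apoly -> Aquot := fun x => (\pi_({ideal_quot Arel_ideal}) x)%qT.

End Presentation.

Definition Astar : comNzRingType := Aquot Ha Hsigma_inv.

Definition xi (i : posnat) : Astar := Aquot_pi Ha Hsigma_inv (pxi Hstar i).
Definition tau (i : nat) : Astar := Aquot_pi Ha Hsigma_inv (ptau Hstar i).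

(* N u {oo}, with [None] standing for oo. *)
Definition enat := option nat.

Definition enat_le (m n : enat) : bool :=
  match m, n with
  | _, None => true
  | None, Some _ => false
  | Some m', Some n' => (m' <= n')%N
  end.

(* min P, with min of the empty set = oo. *)
Definition enat_min (P : nat -> Prop) : enat :=
  if pselect (exists n, `[< P n >]) is left exP then Some (ex_minn exP) else None.

(* x^(2^n), with x^(2^oo) = 0. *)
Definition pow2 (R : nzRingType) (x : R) (n : enat) : R :=
  if n is Some m then x ^+ (2 ^ m) else 0.

Definition profile := ((posnat -> enat) * (nat -> enat))%type.

Definition profile_le (p q : profile) : Prop :=
  (forall n, enat_le (p.1 n) (q.1 n)) /\ (forall n, enat_le (p.2 n) (q.2 n)).

Definition profile_ideal (p : profile) : set Astar :=
  gen_ideal ([set pow2 (xi i) (p.1 i) | i in [set: posnat]] `|`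
             [set pow2 (tau i) (p.2 i) | i in [set: nat]])%classic.

Definition minimal_profile (p : profile) : Prop :=
  forall q, profile_ideal q = profile_ideal p -> profile_le q p -> q = p.

Definition ktilde (p : profile) (n : nat) : enat :=
  enat_min (fun l => profile_ideal p (tau n ^+ (2 ^ l))).

(* Main.v *)
Require Import Defs.
From HB Require Import structures.
From mathcomp Require Import all_boot all_algebra finmap.
From mathcomp Require Import ring_quotient boolp classical_sets.
From mathcomp.multinomials Require Import monalg.

Set Implicit Arguments.
Unset Strict Implicit.
Unset Printing Implicit Defensive.

Import GRing.Theory.
Local Open Scope ring_scope.

(** The heart of the matter is that the ideal I(h, k) remembers h.  The relations
    tau_i^2 = a tau_(i+1) + (s + a tau_0) xi_(i+1), s = sigma^-1, hold trivially
    once a, s and all the tau_i are sent to 0; so, composing with the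
    augmentation H_star -> F_2, there is for every i a ring morphism from A_star
    to F_2[X] that kills H_star in nonzero degrees, all the tau's and all the
    xi's except xi_i, which goes to X.  It maps I(h, k) into the ideal of
    X^(2^h(i)), whence xi_i^(2^n) lies in I(h, k) exactly when n >= h(i)
    ([xi_in_profile_ideal]).  Two profile functions with the same ideal thus have
    the same h ([profile_ideal_inj_xi]).

    Powers of tau_i can enter I(h, k) for a reason other than k(i): by the
    relation above, tau_i^2 lies in it as soon as tau_(i+1) and xi_(i+1) do.
    But the exponents l with tau_i^(2^l) in I(h, k) form an up-closed set, with
    minimum ktilde(i) <= k(i).  Passing from k to ktilde replaces each generator
    tau_i^(2^k(i)) by one that divides it and was already in the ideal, so
    I(h, ktilde) = I(h, k) ([profile_ideal_ktilde]).  Consequently a minimal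
    (h, k) has k = ktilde; conversely, as ktilde and h depend only on the ideal,
    (h, ktilde) lies below every (h', k') with the same ideal.  Both assertions
    follow. *)

(** * Extended naturals *)

Lemma enat_le_anti (m n : enat) : enat_le m n -> enat_le n m -> m = n.
Proof.
by case: m n => [m|] [n|] //= mn nm; congr Some; apply/eqP; rewrite eqn_leq mn.
Qed.

Lemma enat_leP (m n : enat) :
  (forall l : nat, enat_le n (Some l) -> enat_le m (Some l)) <-> enat_le m n.
Proof.
case: m n => [m|] [n|] //=; split=> //.
- exact.
- by move=> mn l; apply: leq_trans.
- by move=> /(_ n (leqnn n)).
Qed.

Lemma enat_minP (P : nat -> Prop) (l : nat) :
  (forall m n, (m <= n)%N -> P m -> P n) -> P l <-> enat_le (enat_min P) (Some l).
Proof.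
move=> Pup; rewrite /enat_min; case: pselect => [exP|noP] /=.
  case: ex_minnP => m /asboolP Pm minP; split=> [Pl|ml]; last exact: Pup Pm.
  exact/minP/asboolP.
by split=> // Pl; case: noP; exists l; apply/asboolP.
Qed.

(** * Ideals *)

Section Ideals.
Variable R : nzRingType.
Implicit Types (S J : set R) (x : R).

Lemma sub_gen_ideal S : (S `<=` gen_ideal S)%classic.
Proof. by move=> x Sx J [_]; apply. Qed.

Lemma gen_ideal_min S J :
  two_sided_ideal J -> (S `<=` J)%classic -> (gen_ideal S `<=` J)%classic.
Proof. by move=> idJ SJ x; apply. Qed.

Lemma pow2_leq_ideal J x (m n : nat) :
  two_sided_ideal J -> (m <= n)%N -> J (x ^+ (2 ^ m)) -> J (x ^+ (2 ^ n)).
Proof.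
move=> [_ _ JM] mn Jm; rewrite -(subnK (leq_pexp2l (isT : (0 < 2)%N) mn)) exprD.
by have [] := JM (x ^+ (2 ^ n - 2 ^ m)) _ Jm.
Qed.

End Ideals.

Lemma preimage_two_sided_ideal (R S : nzRingType) (f : {rmorphism R -> S})
    (J : set S) : two_sided_ideal J -> two_sided_ideal (f @^-1` J)%classic.
Proof.
move=> [J0 JB JM]; split.
- by rewrite /preimage /= rmorph0.
- by move=> x y Jx Jy; rewrite /preimage /= rmorphB; apply: JB.
- by move=> r x Jx; rewrite /preimage /= !rmorphM; apply: JM.
Qed.

Lemma dvdp_two_sided_ideal (F : fieldType) (d : {poly F}) :
  two_sided_ideal (fun p : {poly F} => d %| p).
Proof.
split=> [|p q dp dq|r p dp]; first exact: dvdp0.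
  exact: dvdp_sub.
by split; [exact: dvdp_mull|exact: dvdp_mulr].
Qed.

(** * Evaluation of the presented algebra *)

Section CmonomEval.
Variables (I : choiceType) (S : comNzRingType) (v : I -> S).
Implicit Type m : {cmonom I}.

Definition cmonom_eval m : S := \prod_(i <- finsupp m) v i ^+ m i.

Lemma cmonom_evalEw m (d : {fset I}) : (finsupp m `<=` d)%fset ->
  cmonom_eval m = \prod_(i <- d) v i ^+ m i.
Proof.
move=> le; rewrite /cmonom_eval (big_fset_incl _ le) // => i _.
by rewrite -cmE_eq0 => /eqP ->.
Qed.

Lemma cmonom_eval_is_mmorphism : mmorphism cmonom_eval.
Proof.
split=> [m1 m2|]; last by rewrite /cmonom_eval mdom1 big_seq_fset0.
rewrite [LHS]/cmonom_eval mdomD.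
rewrite (@cmonom_evalEw m1 _ (fsubsetUl _ (finsupp m2))).
rewrite (@cmonom_evalEw m2 _ (fsubsetUr (finsupp m1) _)) -big_split /=.
by apply: eq_bigr => i _; rewrite cmM exprD.
Qed.

HB.instance Definition _ :=
  monalg.isMultiplicative.Build {cmonom I} S cmonom_eval cmonom_eval_is_mmorphism.

Lemma cmonom_evalU i : cmonom_eval (ucm i) = v i.
Proof. by rewrite /cmonom_eval mdomU big_seq_fset1 cmUU expr1. Qed.

End CmonomEval.

Section Lift.
Variables (H S : comNzRingType) (a s : H).
Variables (f : {rmorphism H -> S}) (v : Agen -> S).

Let ev : {rmorphism Apoly H -> S} := mmap f (cmonom_eval v).

Lemma evU g : ev << ucm g >> = v g.
Proof.
have -> : ev << ucm g >> = f 1 * cmonom_eval v (ucm g) by exact: mmapU.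
by rewrite rmorph1 mul1r cmonom_evalU.
Qed.

Lemma evC c : ev c%:MP = f c.
Proof. exact: mmapC. Qed.

(** The universal property of the presentation. *)
Lemma Aquot_lift :
  (forall i, v (inr i) ^+ 2 =
     f a * v (inr i.+1) + (f s + f a * v (inr 0%N)) * v (inl (psucc i))) ->
  exists phi : {rmorphism Aquot a s -> S},
    (forall i, phi (Aquot_pi a s (pxi H i)) = v (inl i)) /\
    (forall i, phi (Aquot_pi a s (ptau H i)) = v (inr i)).
Proof.
move=> rel.
have ev_rel i : ev (Arel a s i) = 0.
  (* Over abstract rings, so that the morphism laws meet opaque operations and
     not those of the monoid algebra. *)
  have rel0 (P Q : comNzRingType) (g : {rmorphism P -> Q}) (t t' x b c t0 : P) :
      g t ^+ 2 = g b * g t' + (g c + g b * g t0) * g x ->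
      g (t ^+ 2 - (b * t' + (c + b * t0) * x)) = 0.
    rewrite rmorphB rmorphXn rmorphD !rmorphM rmorphD rmorphM => ->.
    exact: subrr.
  apply: rel0; have := rel i.
  by rewrite -!evU -(evC a) -(evC s).
have ev_ideal x : x \in Arel_ideal a s -> ev x = 0.
  move=> /asboolP; apply: (@gen_ideal_min _ _ (fun x => ev x = 0)); last first.
    by move=> _ [i _ <-].
  apply: (@preimage_two_sided_ideal _ _ ev (fun y => y = 0)).
  split=> // [x' y -> ->|r x' ->]; first exact: subr0.
  by rewrite mulr0 mul0r.
pose phi (x : Aquot a s) : S := ev (repr x).
have phi_pi x : phi (Aquot_pi a s x) = ev x.
  apply/eqP; rewrite -subr_eq0 -rmorphB; apply/eqP/ev_ideal.
  by rewrite Quotient.idealrBE reprK.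
pose pi : {rmorphism Apoly H -> Aquot a s} :=
  GRing.RMorphism.clone _ _ (\pi_({ideal_quot Arel_ideal a s}))%qT _.
have phi_pi' x : phi (pi x) = ev x by exact: phi_pi.
have piP (x : Aquot a s) : x = pi (repr x) by exact/esym/reprK.
have phiB : zmod_morphism phi.
  by move=> x y; rewrite [x]piP [y]piP -rmorphB !phi_pi' rmorphB.
have phiM : monoid_morphism phi.
  split; first by rewrite -(rmorph1 pi) phi_pi' rmorph1.
  by move=> x y; rewrite [x]piP [y]piP -rmorphM !phi_pi' rmorphM.
pose phi_add := GRing.isZmodMorphism.Build _ _ phi phiB.
pose phi_mul := GRing.isMonoidMorphism.Build _ _ phi phiM.
pose phi' : {rmorphism Aquot a s -> S} := HB.pack phi phi_add phi_mul.
by exists phi'; split=> i; rewrite /phi' /= phi_pi evU.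
Qed.

End Lift.

(** * The augmentation of the coefficient ring *)

(** The coefficient at 1 is multiplicative for two reasons.  A product with a
    factor in the negative cone has no component at 1, since the negative cone is
    an ideal; on the positive cone, 1 is a product of monomials only as 1 * 1. *)
Lemma Hmul_coef1 (f g : Hstar) :
  (f * g)@_(PosCone 0 0) = f@_(PosCone 0 0) * g@_(PosCone 0 0).
Proof.
have monom1 c x y : (Hmonom c (Hbasis_mul x y))@_(PosCone 0 0) =
    c *+ ((x == PosCone 0 0) && (y == PosCone 0 0)).
  case: x y => i j [] k l; rewrite ?andbF //=; last first.
  - exact: mcoeff0.
  - by case: ifP => _; rewrite ?mcoeff0 // mcoeffU.
  - by case: ifP => _; rewrite ?mcoeff0 // mcoeffU.
  rewrite mcoeffU; congr (_ *+ nat_of_bool _).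
  by apply/eqP/andP => [[/eqP + /eqP]|[/eqP[-> ->] /eqP[-> ->]]] //;
     rewrite !addn_eq0 => /andP[/eqP-> /eqP->] /andP[/eqP-> /eqP->].
rewrite -[f * g]/(Hmul f g) [f in RHS]monalgE [g in RHS]monalgE /Hmul !raddf_sum /=.
rewrite mulr_suml; apply: eq_bigr => x _.
rewrite raddf_sum mulr_sumr; apply: eq_bigr => y _.
by rewrite [LHS]monom1 !mcoeffU mulrnAl mulrnAr -mulrnA mulnb andbC.
Qed.

Definition Haug (f : Hstar) : 'F_2 := f@_(PosCone 0 0).

Fact Haug_is_zmod_morphism : zmod_morphism Haug.
Proof. by move=> f g; rewrite /Haug mcoeffB. Qed.

Fact Haug_is_monoid_morphism : monoid_morphism Haug.
Proof. by split; [exact: mcoeffUU|exact: Hmul_coef1]. Qed.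

HB.instance Definition _ :=
  GRing.isZmodMorphism.Build Hstar 'F_2 Haug Haug_is_zmod_morphism.
HB.instance Definition _ :=
  GRing.isMonoidMorphism.Build Hstar 'F_2 Haug Haug_is_monoid_morphism.

(** * The exponents of the xi's *)

(** Setting a, s and every tau_j to 0 turns the relations into 0 = 0, whatever the
    values of the xi_j. *)
Lemma exists_Astar_to_poly (i : posnat) :
  exists phi : {rmorphism Astar -> {poly 'F_2}},
    (forall j, phi (xi j) = if j == i then 'X else 0) /\
    (forall j, phi (tau j) = 0).
Proof.
pose f : {rmorphism Hstar -> {poly 'F_2}} := polyC \o Haug.
pose v (g : Agen) : {poly 'F_2} :=
  if g is inl j then (if j == i then 'X else 0) else 0.
have fa : f Ha = 0 by rewrite /f /= /Haug mcoeffU.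
have fs : f Hsigma_inv = 0 by rewrite /f /= /Haug mcoeffU.
have [|phi [phi_xi phi_tau]] := @Aquot_lift Hstar {poly 'F_2} Ha Hsigma_inv f v.
  by move=> j; rewrite fa fs /= expr0n !(mul0r, addr0).
by exists phi.
Qed.

(** The morphism to F_2[X] attached to i kills the other generators of the ideal,
    so that only the one with index i constrains the powers of xi_i. *)
Lemma xi_in_profile_ideal (p : profile) (i : posnat) (n : nat) :
  profile_ideal p (xi i ^+ (2 ^ n)) <-> enat_le (p.1 i) (Some n).
Proof.
have idI := gen_idealP; split=> [In|]; last first.
  case pi : (p.1 i) => [m|] // mn; apply: pow2_leq_ideal mn _; first exact: idI.
  by apply: sub_gen_ideal; left; exists i; rewrite ?pi.
have [phi [phi_xi phi_tau]] := exists_Astar_to_poly i.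
have phi_pow2 x m : phi (pow2 x m) = pow2 (phi x) m.
  by case: m => [m|]; [exact: rmorphXn|exact: rmorph0].
have pow2_0 m : pow2 (0 : {poly 'F_2}) m = 0.
  by case: m => [m|] //=; rewrite expr0n expn_eq0.
pose J := (phi @^-1` (fun q => pow2 'X (p.1 i) %| q))%classic.
have idJ : two_sided_ideal J.
  by apply: preimage_two_sided_ideal; exact: dvdp_two_sided_ideal.
have : J (xi i ^+ (2 ^ n)).
  move: In; apply: gen_ideal_min idJ _ _.
  move=> _ [[j _ <-]|[j _ <-]]; rewrite /J /preimage /= phi_pow2.
    by rewrite phi_xi; case: eqP => [->|_] //; rewrite pow2_0 dvdp0.
  by rewrite phi_tau pow2_0 dvdp0.
rewrite /J /preimage /= rmorphXn phi_xi eqxx; case: (p.1 i) => [m|] /=.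
  by rewrite dvdp_Pexp2l ?size_polyX // leq_exp2l.
by rewrite dvd0p expf_eq0 polyX_eq0 andbF.
Qed.

Lemma profile_ideal_inj_xi (p q : profile) :
  profile_ideal p = profile_ideal q -> p.1 = q.1.
Proof.
move=> eqI; apply/funext => i.
by apply: enat_le_anti; apply/enat_leP => l;
   rewrite -!xi_in_profile_ideal eqI.
Qed.

(** * The exponents of the tau's *)

Lemma tau_in_profile_ideal (p : profile) (i n : nat) :
  enat_le (p.2 i) (Some n) -> profile_ideal p (tau i ^+ (2 ^ n)).
Proof.
case pi : (p.2 i) => [m|] // mn; apply: pow2_leq_ideal mn _.
  exact: gen_idealP.
by apply: sub_gen_ideal; right; exists i; rewrite ?pi.
Qed.

Lemma ktildeP (p : profile) (i n : nat) :
  profile_ideal p (tau i ^+ (2 ^ n)) <-> enat_le (ktilde p i) (Some n).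
Proof.
apply: enat_minP => m l ml; apply: pow2_leq_ideal ml; exact: gen_idealP.
Qed.

Lemma ktilde_le (p : profile) (i : nat) : enat_le (ktilde p i) (p.2 i).
Proof. by apply/enat_leP => l /tau_in_profile_ideal/ktildeP. Qed.

Lemma eq_ktilde (p q : profile) :
  profile_ideal p = profile_ideal q -> ktilde p = ktilde q.
Proof. by rewrite /ktilde => ->. Qed.

Lemma pow2_ideal (R : nzRingType) (J : set R) (x : R) (n : enat) :
  two_sided_ideal J -> (forall m, enat_le n (Some m) -> J (x ^+ (2 ^ m))) ->
  J (pow2 x n).
Proof. by move=> [J0 _ _]; case: n => [n|] // Jx; apply: Jx => /=. Qed.

Lemma profile_ideal_sub (p q : profile) : p.1 = q.1 ->
  (forall i n, enat_le (p.2 i) (Some n) -> profile_ideal q (tau i ^+ (2 ^ n))) ->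
  (profile_ideal p `<=` profile_ideal q)%classic.
Proof.
move=> eq1 tauq; have idq := gen_idealP _ : two_sided_ideal (profile_ideal q).
apply: gen_ideal_min => // _ [[i _ <-]|[i _ <-]].
  by apply: sub_gen_ideal; left; exists i; rewrite // eq1.
by apply: pow2_ideal idq _ => m; exact: tauq.
Qed.

Lemma profile_ideal_ktilde (p : profile) :
  profile_ideal p = profile_ideal (p.1, ktilde p).
Proof.
rewrite eqEsubset; split; apply: profile_ideal_sub => //= i n.
  move=> pin; apply: tau_in_profile_ideal; apply/ktildeP.
  exact: tau_in_profile_ideal.
by move/ktildeP.
Qed.

(** * Minimal profile functions *)

(** Among the profile functions with a given ideal, h and ktilde are constant and
    k >= ktilde, so that (h, ktilde) is the least one. *)
Lemma minimal_profileP (p : profile) : minimal_profile p <-> p.2 = ktilde p.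
Proof.
split=> [minp|p2 q eqI [_ le2]].
  have pE : (p.1, ktilde p) = p.
    apply: minp; first exact/esym/profile_ideal_ktilde.
    by split=> i /=; [case: (p.1 i) => /=|exact: ktilde_le].
  by rewrite -[in LHS]pE.
have q1 := profile_ideal_inj_xi eqI.
have q2 : q.2 = p.2.
  apply/funext => i; apply: enat_le_anti (le2 i) _.
  by rewrite p2 -(eq_ktilde eqI); exact: ktilde_le.
by rewrite [q]surjective_pairing q1 q2 -surjective_pairing.
Qed.

Theorem lemma5p10 :
  (forall (h : posnat -> enat) (k : nat -> enat),
      minimal_profile (h, k) <->
      (forall i n : nat,
          profile_ideal (h, k) (tau i ^+ (2 ^ n)) <-> enat_le (k i) (Some n)))
  /\
  (forall (h : posnat -> enat) (k : nat -> enat),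
      [/\ minimal_profile (h, ktilde (h, k)),
          profile_ideal (h, k) = profile_ideal (h, ktilde (h, k))
        & forall p : profile,
            minimal_profile p -> profile_ideal (h, k) = profile_ideal p ->
            p = (h, ktilde (h, k))]).
Proof.
split=> h k.
  split=> [/minimal_profileP/= kE i n|tauP]; first by rewrite {2}kE; exact: ktildeP.
  apply/minimal_profileP/funext => i /=.
  by apply: enat_le_anti; apply/enat_leP => l;
     [move/ktildeP/tauP|move/tauP/ktildeP].
have eqI := profile_ideal_ktilde (h, k); split=> //.
  by apply/minimal_profileP; exact: eq_ktilde.
move=> p /minimal_profileP p2 eqIp.
by rewrite [p]surjective_pairing p2 -(eq_ktilde eqIp) -(profile_ideal_inj_xi eqIp).
Qed.
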